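(* If $0<\mathrm{Ste}<1$, there exists at least one solution to problem $(\mathrm{P}_1)$, given by $$T_1(x,t)=t^{\alpha/2}\theta_\infty\left[A_1\left(1-\frac{x}{s_1(t)}\right)+B_1\left(1-\frac{x}{s_1(t)}\right)^2\right],\qquad s_1(t)=2a\nu_1\sqrt{t},$$ where the constants $A_1,B_1$ are defined as functions of $\nu_1$ by $$A_1=\frac{-2\left[3\cdot 2^{\alpha}\nu_1^{\alpha+2}+\mathrm{Ste}\left(-3+(1+\alpha)\nu_1^2\right)\right]}{\mathrm{Ste}\left(3+(1+\alpha)\nu_1^2\right)},\qquad B_1=\frac{3\left[2^{\alpha+1}\nu_1^{\alpha+2}+\mathrm{Ste}\left(-1+(1+\alpha)\nu_1^2\right)\right]}{\mathrm{Ste}\left(3+(1+\alpha)\nu_1^2\right)},$$ and the coefficient $\nu_1>0$ is a solution to the equation (in the unknown $z>0$) $$\begin{aligned}&-3\cdot 2^{2\alpha+1}(\alpha-2)z^{2\alpha+4}-9\cdot 2^{2\alpha+1}z^{2\alpha+2}-3\cdot 2^{\alpha}(\alpha-3)(\alpha+1)\mathrm{Ste}\,z^{\alpha+4}\\&-3\cdot 2^{\alpha+1}(\alpha+7)\mathrm{Ste}\,z^{\alpha+2}+9\cdot 2^{\alpha}\mathrm{Ste}\,z^{\alpha}+2(\alpha+1)^2\mathrm{Ste}^2z^4-12(\alpha+1)\mathrm{Ste}^2z^2+18\,\mathrm{Ste}^2=0.\end{aligned}$$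
   Context: Fix real parameters $k,\rho,c,\gamma,\theta_\infty>0$ and $\alpha\ge 0$; put $a=\sqrt{k/(\rho c)}$ and define the generalized Stefan number $\mathrm{Ste}=\dfrac{k\theta_\infty}{\gamma a^{\alpha+2}}$. A candidate pair $(T,s)$ consists of a continuous function $s:[0,\infty)\to[0,\infty)$, positive and continuously differentiable on $(0,\infty)$, and a function with quadratic profile in space $$T(x,t)=t^{\alpha/2}\theta_\infty\left[A\left(1-\frac{x}{s(t)}\right)+B\left(1-\frac{x}{s(t)}\right)^2\right],\quad 0\le x\le s(t),\ t>0,$$ with real constants $A,B$. Problem $(\mathrm{P}_1)$ (classical heat balance integral method, Dirichlet condition): find a candidate pair $(T,s)=(T_1,s_1)$ such that, for all $t>0$: (i) $\dfrac{d}{dt}\displaystyle\int_0^{s(t)}T(x,t)\,dx=-a^2\left[\dfrac{\gamma}{k}s(t)^{\alpha}\dot s(t)+\dfrac{\partial T}{\partial x}(0,t)\right]$; (ii) $T(0,t)=\theta_\infty t^{\alpha/2}$; (iii) $T(s(t),t)=0$; (iv) $\dfrac{k}{\gamma s(t)^{\alpha}}\left[\dfrac{\partial T}{\partial x}(s(t),t)\right]^2=a^2\dfrac{\partial^2T}{\partial x^2}(s(t),t)$; and (v) $s(0)=0$. *)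

(* Defs.v *)
From Stdlib Require Import Reals.
From Coquelicot Require Import Coquelicot.
Open Scope R_scope.

Definition diffusivity_root (k rho c : R) : R := sqrt (k / (rho * c)).

(* Generalized Stefan number; [a] is [diffusivity_root k rho c]. *)
Definition Stefan (k gamma theta alpha a : R) : R :=
  k * theta / (gamma * Rpower a (alpha + 2)).

(* Temperatures are total functions [R -> R -> R], of which only the values at
   0 <= x <= s(t), t > 0 are meaningful. *)
Definition quadratic_profile (theta alpha A B : R) (s : R -> R) (x t : R) : R :=
  Rpower t (alpha / 2) * theta *
    (A * (1 - x / s t) + B * (1 - x / s t) ^ 2).

Definition segment (b x : R) : Prop := 0 <= x <= b.

Record candidate_pair (theta alpha : R) (T : R -> R -> R) (s : R -> R) : Prop := {
  cand_s_nonneg : forall t, 0 <= t -> 0 <= s t;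
  cand_s_cont   : continuous_on (fun t => 0 <= t) s;
  cand_s_pos    : forall t, 0 < t -> 0 < s t;
  cand_s_C1     : forall t, 0 < t -> ex_derive s t /\ continuous (Derive s) t;
  cand_profile  : exists A B : R, forall t x, 0 < t -> segment (s t) x ->
                    T x t = quadratic_profile theta alpha A B s x t
}.

(* [Tx] and [Txx] are the first and second partial derivatives of [T] in [x]
   on 0 <= x <= s(t), t > 0; [D_in] takes the derivative within the segment, so
   it is one-sided at x = 0 and x = s(t), where it is still unique because
   s(t) > 0. *)
Definition space_derivatives (T Tx Txx : R -> R -> R) (s : R -> R) : Prop :=
  forall t x, 0 < t -> segment (s t) x ->
    D_in (fun y => T y t) (fun y => Tx y t) (segment (s t)) x /\
    D_in (fun y => Tx y t) (fun y => Txx y t) (segment (s t)) x.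

Definition solves_P1 (k gamma theta alpha a : R)
    (T : R -> R -> R) (s : R -> R) : Prop :=
  candidate_pair theta alpha T s /\
  (exists Tx Txx : R -> R -> R,
     space_derivatives T Tx Txx s /\
     forall t, 0 < t ->
       is_derive (fun u => RInt (fun x => T x u) 0 (s u)) t
         (- a ^ 2 * (gamma / k * Rpower (s t) alpha * Derive s t + Tx 0 t)) /\
       T 0 t = theta * Rpower t (alpha / 2) /\
       T (s t) t = 0 /\
       k / (gamma * Rpower (s t) alpha) * (Tx (s t) t) ^ 2
         = a ^ 2 * Txx (s t) t) /\
  s 0 = 0.

Definition A1 (alpha Ste nu : R) : R :=
  - 2 * (3 * Rpower 2 alpha * Rpower nu (alpha + 2)
         + Ste * (- 3 + (1 + alpha) * nu ^ 2))
  / (Ste * (3 + (1 + alpha) * nu ^ 2)).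

Definition B1 (alpha Ste nu : R) : R :=
  3 * (Rpower 2 (alpha + 1) * Rpower nu (alpha + 2)
       + Ste * (- 1 + (1 + alpha) * nu ^ 2))
  / (Ste * (3 + (1 + alpha) * nu ^ 2)).

Definition s1 (a nu t : R) : R := 2 * a * nu * sqrt t.

Definition T1 (theta alpha Ste a nu : R) : R -> R -> R :=
  quadratic_profile theta alpha (A1 alpha Ste nu) (B1 alpha Ste nu) (s1 a nu).

Definition nu1_equation (alpha Ste z : R) : Prop :=
  - 3 * Rpower 2 (2 * alpha + 1) * (alpha - 2) * Rpower z (2 * alpha + 4)
  - 9 * Rpower 2 (2 * alpha + 1) * Rpower z (2 * alpha + 2)
  - 3 * Rpower 2 alpha * (alpha - 3) * (alpha + 1) * Ste * Rpower z (alpha + 4)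
  - 3 * Rpower 2 (alpha + 1) * (alpha + 7) * Ste * Rpower z (alpha + 2)
  + 9 * Rpower 2 alpha * Ste * Rpower z alpha
  + 2 * (alpha + 1) ^ 2 * Ste ^ 2 * z ^ 4
  - 12 * (alpha + 1) * Ste ^ 2 * z ^ 2
  + 18 * Ste ^ 2 = 0.

(* Main.v *)
(** With [s(t) = 2 a nu sqrt t] every condition of the problem loses its
    dependence on [t].  Conditions (i) and (ii) become a linear system for
    [(A, B)], solved by [(A1, B1)], and condition (iv) becomes
    [Ste * A1^2 = 2^(alpha+1) nu^alpha B1], which is the equation for [nu] after
    clearing denominators.  For existence, [A1 + B1 = 1], so the defect
    [Ste * A1^2 - 2^(alpha+1) nu^alpha B1] is positive where [B1 < 0], which
    holds for small [nu], and negative where [A1 = 0], which happens before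
    [nu = 1]; the intermediate value theorem gives a zero in between. *)
From Stdlib Require Import Reals Ranalysis5 Lra.
From Coquelicot Require Import Coquelicot.
(* Imported last because [Reals] has its own [A1] and [B1]. *)
Require Import Defs.
Open Scope R_scope.

(** Intermediate value theorem for a sign change from positive to negative, hence applied to [- f].
    Differentiability is assumed rather than continuity because [auto_derive] settles it for the
    functions below. *)
Lemma root_of_sign_change (f : R -> R) (x y : R) :
  (forall z, 0 < z -> ex_derive f z) -> 0 < x < y -> 0 < f x -> f y < 0 ->
  exists z, x <= z <= y /\ f z = 0.
Proof.
intros Hf Hxy Hx Hy.
destruct (IVT_interv (fun z => - f z) x y) as [z [Hz Hz0]]; try lra.
- intros z Hz. apply continuity_pt_opp, continuity_pt_filterlim.
  apply (ex_derive_continuous f), Hf; lra.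
- exists z; split; [exact Hz | lra].
Qed.

Lemma Rpower_base_1 (b : R) : Rpower 1 b = 1.
Proof. unfold Rpower. now rewrite ln_1, Rmult_0_r, exp_0. Qed.

Lemma Rpower_add_2 (z b : R) : 0 < z -> Rpower z (b + 2) = Rpower z b * z ^ 2.
Proof.
intros hz. rewrite Rpower_plus. f_equal.
exact (Rpower_pow 2 z hz).
Qed.

Lemma Rpower_add_4 (z b : R) : 0 < z -> Rpower z (b + 4) = Rpower z b * z ^ 4.
Proof.
intros hz. replace (b + 4) with (b + 2 + 2) by ring.
rewrite !Rpower_add_2 by exact hz. ring.
Qed.

Lemma Rpower_double (z b : R) : Rpower z (2 * b) = Rpower z b ^ 2.
Proof.
replace (2 * b) with (b + b) by ring. rewrite Rpower_plus. ring.
Qed.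

Lemma A1_den_pos (alpha nu : R) : 0 <= alpha -> 0 < 3 + (1 + alpha) * nu ^ 2.
Proof.
intros ha. assert (H := pow2_ge_0 nu).
assert (H' := Rmult_le_pos _ _ ha H). lra.
Qed.

(** This is condition (ii), since the profile at [x = 0] carries the factor [A + B]. It also lets
    the sign arguments trade [A1] for [B1]. *)
Lemma A1_add_B1 (alpha Ste nu : R) :
  0 <= alpha -> 0 < Ste -> A1 alpha Ste nu + B1 alpha Ste nu = 1.
Proof.
intros ha hS. assert (hD := A1_den_pos alpha nu ha).
unfold A1, B1. rewrite (Rpower_plus alpha 1 2), Rpower_1 by lra.
field. split; lra.
Qed.

(** With [D] the denominator factor shared by [A1] and [B1], the two left-hand sides differ by the
    positive factor [2 / (Ste * D ^ 2)]. *)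
Lemma nu1_equationE (alpha Ste nu : R) : 0 <= alpha -> 0 < Ste -> 0 < nu ->
  nu1_equation alpha Ste nu <->
  Ste * A1 alpha Ste nu ^ 2
  - 2 * Rpower 2 alpha * Rpower nu alpha * B1 alpha Ste nu = 0.
Proof.
intros ha hS hn. assert (hD := A1_den_pos alpha nu ha).
unfold nu1_equation, A1, B1.
rewrite !Rpower_add_4, !Rpower_add_2, !Rpower_plus, !Rpower_double,
  !Rpower_1 by lra.
set (M := Rpower 2 alpha). set (p := Rpower nu alpha).
set (D := 3 + (1 + alpha) * nu ^ 2) in *.
match goal with |- ?E = 0 <-> ?F = 0 =>
  assert (HEF : F = 2 * E / (Ste * D ^ 2)) by (unfold D in *; field; lra);
  rewrite HEF; set (e := E) end.
assert (hSD : 0 < Ste * D ^ 2) by (apply Rmult_lt_0_compat, pow_lt; lra).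
split; intros H.
- rewrite H. field. lra.
- replace e with (2 * e / (Ste * D ^ 2) * (Ste * D ^ 2 / 2)) by (field; lra).
  rewrite H. ring.
Qed.

Lemma ex_derive_A1 (alpha Ste nu : R) : 0 <= alpha -> 0 < Ste -> 0 < nu ->
  ex_derive (A1 alpha Ste) nu.
Proof.
intros ha hS hn. assert (hD := A1_den_pos alpha nu ha).
unfold A1, Rpower. auto_derive. split; [exact hn|split; [|exact I]].
simpl in hD. apply Rgt_not_eq, Rmult_lt_0_compat; lra.
Qed.

Lemma ex_derive_B1 (alpha Ste nu : R) : 0 <= alpha -> 0 < Ste -> 0 < nu ->
  ex_derive (B1 alpha Ste) nu.
Proof.
intros ha hS hn. assert (hD := A1_den_pos alpha nu ha).
unfold B1, Rpower. auto_derive. split; [exact hn|split; [|exact I]].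
simpl in hD. apply Rgt_not_eq, Rmult_lt_0_compat; lra.
Qed.

Lemma Rpower_ge_1 (x b : R) : 1 <= x -> 0 <= b -> 1 <= Rpower x b.
Proof.
intros hx hb. rewrite <- (Rpower_O x) by lra. apply Rle_Rpower; lra.
Qed.

Lemma Rpower_le_1 (x b : R) : 0 < x <= 1 -> 0 <= b -> Rpower x b <= 1.
Proof.
intros hx hb. rewrite <- (Rpower_base_1 b). apply Rle_Rpower_l; lra.
Qed.

Lemma B1_neg_near_0 (alpha Ste : R) : 0 <= alpha -> 0 < Ste ->
  exists nu, 0 < nu < 1 /\ B1 alpha Ste nu < 0.
Proof.
intros ha hS.
assert (hM := Rpower_ge_1 2 alpha ltac:(lra) ha).
set (M := Rpower 2 alpha) in *.
assert (hSb : 0 <= Ste * alpha) by (apply Rmult_le_pos; lra).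
(* For [0 < z < 1], the positive terms in the numerator of [B1] sum to at most [Q * z ^ 2 <= Q * z].
   The choice of [z] below makes [Q * z = Ste - z], just under the negative term. *)
set (Q := 2 * M + Ste * (1 + alpha)).
assert (hQ : Ste < Q) by (unfold Q; lra).
set (z := Ste / (Q + 1)).
assert (hz : 0 < z) by (apply Rdiv_lt_0_compat; lra).
assert (hzQ : z * Q + z = Ste) by (unfold z; field; lra).
assert (hz1 : z < 1).
{ apply (Rmult_lt_reg_r (Q + 1)); lra. }
exists z; split; [lra|].
assert (hD := A1_den_pos alpha z ha).
assert (hp := Rpower_le_1 z alpha ltac:(lra) ha).
assert (hz2 : z ^ 2 <= z) by nra.
assert (hz2' : 0 <= z ^ 2) by nra.
unfold B1. apply Rdiv_neg_pos; [|apply Rmult_lt_0_compat; lra].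
rewrite Rpower_add_2, Rpower_plus, Rpower_1 by lra. fold M.
set (p := Rpower z alpha) in *. set (y := z ^ 2) in *.
assert (h1 : M * (p * y) <= M * y) by (apply Rmult_le_compat_l; nra).
assert (h2 : y * Q <= z * Q) by (apply Rmult_le_compat_r; lra).
unfold Q in *. lra.
Qed.

(** The upper bound on [Ste] enters here: the bracket in [A1] becomes
    [3 * 2^alpha + Ste * (alpha - 2)], which exceeds [3 - 2]. *)
Lemma A1_at_1_neg (alpha Ste : R) : 0 <= alpha -> 0 < Ste < 1 ->
  A1 alpha Ste 1 < 0.
Proof.
intros ha hS. assert (hD := A1_den_pos alpha 1 ha).
assert (hM := Rpower_ge_1 2 alpha ltac:(lra) ha).
assert (hSa : 0 <= Ste * alpha) by (apply Rmult_le_pos; lra).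
unfold A1. apply Rdiv_neg_pos; [|apply Rmult_lt_0_compat; lra].
rewrite Rpower_base_1. lra.
Qed.

Lemma nu1_equation_solvable (alpha Ste : R) : 0 <= alpha -> 0 < Ste < 1 ->
  exists nu, 0 < nu /\ nu1_equation alpha Ste nu.
Proof.
intros ha hS.
destruct (B1_neg_near_0 alpha Ste) as [z0 [hz0 hB0]]; try lra.
assert (hAB := fun nu => A1_add_B1 alpha Ste nu ha (proj1 hS)).
destruct (root_of_sign_change (A1 alpha Ste) z0 1) as [zA [hzA hA]].
{ intros z hz. apply ex_derive_A1; lra. }
{ exact hz0. }
{ specialize (hAB z0). lra. }
{ now apply A1_at_1_neg. }
assert (hM : forall z, 0 < 2 * Rpower 2 alpha * Rpower z alpha).
{ intros z. repeat apply Rmult_lt_0_compat; try apply exp_pos; lra. }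
(* The root [zA] is only known to lie in a closed interval; [B1] is negative at [z0] but equals 1 at
   [zA], so the next interval is nondegenerate. *)
assert (hne : z0 <> zA) by (intros ->; specialize (hAB zA); lra).
destruct (root_of_sign_change (fun z => Ste * A1 alpha Ste z ^ 2
  - 2 * Rpower 2 alpha * Rpower z alpha * B1 alpha Ste z) z0 zA)
  as [nu [hnu hE]].
- intros z hz. unfold Rpower. auto_derive.
  split; [apply ex_derive_A1; lra|].
  split; [exact hz|split; [apply ex_derive_B1; lra|exact I]].
- lra.
- specialize (hM z0). assert (h := pow2_ge_0 (A1 alpha Ste z0)). nra.
- rewrite hA. replace (B1 alpha Ste zA) with 1 by (specialize (hAB zA); lra).
  specialize (hM zA). lra.
- exists nu. split; [lra|]. apply nu1_equationE; lra.
Qed.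

(** Condition (i) freed of [t]: the growth of the heat content equals the flux entering at [x = 0]
    minus the latent heat absorbed at the front. *)
Lemma heat_balance_coefficients (alpha Ste nu : R) :
  0 <= alpha -> 0 < Ste -> 0 < nu ->
  Ste * ((alpha + 1) * nu ^ 2 * (A1 alpha Ste nu / 2 + B1 alpha Ste nu / 3))
  = Ste * (A1 alpha Ste nu + 2 * B1 alpha Ste nu) / 2
    - Rpower 2 alpha * Rpower nu alpha * nu ^ 2.
Proof.
intros ha hS hn. assert (hD := A1_den_pos alpha nu ha).
unfold A1, B1. rewrite Rpower_add_2, Rpower_plus, Rpower_1 by lra.
field. split; lra.
Qed.

Lemma is_RInt_quadratic (K L A B : R) : L <> 0 ->
  is_RInt (fun x => K * (A * (1 - x / L) + B * (1 - x / L) ^ 2)) 0 L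
    (K * L * (A / 2 + B / 3)).
Proof.
intros hL.
set (F := fun x =>
  - K * L * (A / 2 * (1 - x / L) ^ 2 + B / 3 * (1 - x / L) ^ 3)).
replace (K * L * (A / 2 + B / 3)) with (minus (F L) (F 0)).
2:{ unfold F, minus, plus, opp; simpl. field. exact hL. }
apply (is_RInt_derive F).
- intros x _. unfold F. auto_derive; [trivial|]. field. exact hL.
- intros x _. apply (ex_derive_continuous (V := R_NormedModule)).
  now auto_derive.
Qed.

(** The profile is polynomial in [x] on the whole line, so restricting its two-sided derivative also
    covers the endpoints of the segment. *)
Lemma is_derive_D_in (f f' : R -> R) (D : R -> Prop) (x : R) :
  is_derive f x (f' x) -> D_in f f' D x.
Proof.
intros H. apply is_derive_Reals, derivable_pt_lim_D_in in H.
apply (limit1_imp _ (D_x no_cond x)); [|exact H].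
intros y [_ hy]. now split.
Qed.

Lemma is_derive_s1 (a nu t : R) : 0 < t ->
  is_derive (s1 a nu) t (a * nu / sqrt t).
Proof.
intros ht. assert (hr := sqrt_lt_R0 t ht).
unfold s1. auto_derive; [exact ht|]. field. lra.
Qed.

Lemma candidate_similarity (theta alpha A B a nu : R) : 0 < a -> 0 < nu ->
  candidate_pair theta alpha
    (quadratic_profile theta alpha A B (s1 a nu)) (s1 a nu).
Proof.
intros ha hn.
assert (han : 0 < 2 * a * nu) by (repeat apply Rmult_lt_0_compat; lra).
split.
- intros t _. apply Rmult_le_pos; [lra | apply sqrt_pos].
- apply continuous_on_forall. intros t _.
  apply (continuous_scal_r (2 * a * nu) sqrt t), continuous_sqrt.
- intros t ht. apply Rmult_lt_0_compat; [lra | now apply sqrt_lt_R0].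
- intros t ht. split; [eexists; now apply is_derive_s1|].
  apply (continuous_ext_loc _ (fun u => a * nu / sqrt u)).
  + apply (filter_imp (fun u => 0 < u)); [|now apply open_gt].
    intros u hu. symmetry. now apply is_derive_unique, is_derive_s1.
  + apply (ex_derive_continuous (V := R_NormedModule)). auto_derive.
    assert (hr := sqrt_lt_R0 t ht). split; [exact ht|split; [lra|exact I]].
- now exists A, B.
Qed.

Lemma Rpower_sqrt_base (t b : R) : 0 < t ->
  Rpower (sqrt t) b = Rpower t (b / 2).
Proof.
intros ht. rewrite <- Rpower_sqrt, Rpower_mult by exact ht. f_equal. field.
Qed.

Theorem theorem3p1 (k rho c gamma theta alpha : R)
  (hk : 0 < k) (hrho : 0 < rho) (hc : 0 < c) (hgamma : 0 < gamma)
  (htheta : 0 < theta) (halpha : 0 <= alpha) :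
  let a := diffusivity_root k rho c in
  let Ste := Stefan k gamma theta alpha a in
  0 < Ste < 1 ->
  (exists nu, 0 < nu /\ nu1_equation alpha Ste nu) /\
  (forall nu, 0 < nu -> nu1_equation alpha Ste nu ->
     solves_P1 k gamma theta alpha a (T1 theta alpha Ste a nu) (s1 a nu)).
Proof.
intros a Ste hSte. split; [now apply nu1_equation_solvable|].
intros nu hnu hE.
assert (ha : 0 < a).
{ apply sqrt_lt_R0, Rdiv_lt_0_compat; [|apply Rmult_lt_0_compat]; assumption. }
clearbody a.
apply nu1_equationE in hE; [|lra..].
assert (hbal := heat_balance_coefficients alpha Ste nu halpha (proj1 hSte) hnu).
assert (hAB := A1_add_B1 alpha Ste nu halpha (proj1 hSte)).
split; [now apply candidate_similarity|].
split; [|unfold s1; rewrite sqrt_0; ring].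
unfold T1, quadratic_profile.
set (A := A1 alpha Ste nu) in *. set (B := B1 alpha Ste nu) in *.
set (M := Rpower 2 alpha) in *. set (p := Rpower nu alpha) in *.
assert (hp : 0 < p) by apply exp_pos.
assert (hM : 0 < M) by apply exp_pos.
set (pa := Rpower a alpha).
assert (hpa : 0 < pa) by apply exp_pos.
(* Solving the definition of [Ste] for [theta] lets [Ste] become an opaque variable, leaving
   rational identities for [field]. *)
assert (htheta' : theta = Ste * (gamma * (pa * a ^ 2)) / k).
{ unfold Ste, Stefan. rewrite Rpower_add_2 by exact ha. fold pa. field.
  repeat split; lra. }
clearbody Ste A B.
assert (hs : forall t, 0 < t -> 0 < s1 a nu t).
{ intros t ht. unfold s1.
  repeat apply Rmult_lt_0_compat; try apply sqrt_lt_R0; lra. }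
exists (fun x t => - Rpower t (alpha / 2) * theta / s1 a nu t *
          (A + 2 * B * (1 - x / s1 a nu t))),
  (fun x t => Rpower t (alpha / 2) * theta * (2 * B) / s1 a nu t ^ 2).
split.
{ intros t x ht _. specialize (hs t ht).
  split; apply is_derive_D_in; (auto_derive; [trivial|field; lra]). }
intros t ht. assert (hr := sqrt_lt_R0 t ht).
assert (hpow : Rpower (s1 a nu t) alpha
  = M * pa * p * Rpower t (alpha / 2)).
{ unfold s1.
  rewrite <- !Rpower_mult_distr, Rpower_sqrt_base
    by (repeat apply Rmult_lt_0_compat; lra).
  reflexivity. }
clearbody M p pa.
assert (hPt : 0 < Rpower t (alpha / 2)) by apply exp_pos.
specialize (hs t ht) as hst.
split; [|split; [|split]].
(* The closed form of the integral needs [s1 a nu u <> 0], hence only a local replacement near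
   [t > 0]. *)
- apply is_derive_ext_loc with (f := fun u =>
    Rpower u (alpha / 2) * theta * s1 a nu u * (A / 2 + B / 3)).
  { apply (filter_imp (fun u => 0 < u)); [|now apply open_gt].
    intros u hu. symmetry. apply is_RInt_unique, is_RInt_quadratic.
    specialize (hs u hu). lra. }
  rewrite (is_derive_unique _ _ _ (is_derive_s1 a nu t ht)), hpow.
  unfold s1, Rpower. auto_derive; [now repeat split|].
  change (exp (alpha / 2 * ln t)) with (Rpower t (alpha / 2)).
  set (P := Rpower t (alpha / 2)) in *.
  set (r := sqrt t) in *.
  (* Writing [t] as [r ^ 2] makes both sides rational in [r], with the power [P] kept opaque. *)
  assert (hrt : t = r ^ 2) by (unfold r; simpl; rewrite Rmult_1_r, sqrt_sqrt; lra).
  clearbody P r.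
  (* The prefactor is what both sides share; the cofactor is the left side of [hbal]. *)
  transitivity (P * gamma * pa * a ^ 3 / (k * r * nu)
    * (Ste * ((alpha + 1) * nu ^ 2 * (A / 2 + B / 3)))).
  + rewrite htheta', hrt. field. repeat split; lra.
  + rewrite hbal, htheta'. field. repeat split; lra.
- replace (0 / s1 a nu t) with 0 by (field; lra).
  rewrite Rminus_0_r. replace B with (1 - A) by lra. ring.
- field. lra.
- rewrite hpow.
  (* Isolates [Ste * A ^ 2], which [hE] turns into [2 * M * p * B]. *)
  transitivity (a ^ 2 * Rpower t (alpha / 2) * theta
    / (M * p * s1 a nu t ^ 2) * (Ste * A ^ 2)).
  + rewrite htheta'. field. repeat split; lra.
  + replace (Ste * A ^ 2) with (2 * M * p * B) by lra.
    field. repeat split; lra.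
Qed.
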